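(* There exist absolute constants $C>0$ and $\theta_0\in(0,1)$ such that for every Borel probability measure $\mu$ on $\mathbb{S}^1$ and every $0<\theta<\theta_0$, $$\mathbb{P}_\mu(\ell<1-\theta)\le\frac13-C\theta^2.$$
   Context: $\mathbb{S}^1\subset\mathbb{R}^2$ is the unit circle centered at the origin. For $x,y\in\mathbb{S}^1$ with $x\ne y$, $\operatorname{aff}(x,y)$ is the line through $x$ and $y$; $\operatorname{aff}(x,x)$ is the tangent line to $\mathbb{S}^1$ at $x$. Define $f:(\mathbb{S}^1)^4\to[0,\infty]$ by: $f(x_1,x_2,x_3,x_4)=\|x_0\|_2$ if $\operatorname{aff}(x_1,x_2)\cap\operatorname{aff}(x_3,x_4)=\{x_0\}$ is a single point; $f(x_1,x_2,x_3,x_4)=$ the Euclidean distance from the line $\operatorname{aff}(x_1,x_2)$ to the origin if $\operatorname{aff}(x_1,x_2)=\operatorname{aff}(x_3,x_4)$; $f(x_1,x_2,x_3,x_4)=\infty$ if $\operatorname{aff}(x_1,x_2)\cap\operatorname{aff}(x_3,x_4)=\emptyset$. For a Borel probability measure $\mu$ on $\mathbb{S}^1$, $\mathbb{P}_\mu(\ell<r):=\mu^{\otimes 4}(\{f<r\})$, i.e. $\ell=f(X_1,X_2,X_3,X_4)$ with $X_i$ independent and $\mu$-distributed. *)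

(* Defs.v *)
From HB Require Import structures.
From mathcomp Require Import all_boot all_order all_algebra.
From mathcomp Require Import all_classical all_reals all_analysis.

Set Implicit Arguments.
Unset Strict Implicit.
Unset Printing Implicit Defensive.

Import Order.TTheory GRing.Theory Num.Theory.
Import numFieldNormedType.Exports.

Local Open Scope classical_set_scope.
Local Open Scope ring_scope.

(* The library norm on R * R is the sup norm, hence this separate definition;
   the topology is the same. *)
Definition enorm (R : realType) (p : R * R) : R :=
  Num.sqrt (p.1 ^+ 2 + p.2 ^+ 2).

Definition unit_circle (R : realType) : set (R * R) := [set p | enorm p = 1].

Lemma unit_circle_east (R : realType) : ((1, 0) : R * R) \in @unit_circle R.
Proof. by rewrite inE /unit_circle /enorm /= expr1n expr0n addr0 sqrtr1. Qed.

(* The coercion of sets to types gives the sigma type its subspace topology.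
   The base point is only there because measurable types are pointed. *)
Definition circle (R : realType) : Type := @unit_circle R.
HB.instance Definition _ (R : realType) := Topological.on (circle R).
HB.instance Definition _ (R : realType) :=
  isPointed.Build (circle R) (exist _ (1, 0) (unit_circle_east R)).

Definition borel_circle (R : realType) : Type :=
  g_sigma_algebraType (@open (circle R)).
HB.instance Definition _ (R : realType) := Measurable.on (borel_circle R).

Definition secant (R : realType) (x y : R * R) : set (R * R) :=
  [set p | exists t : R,
     p = (x.1 + t * (y.1 - x.1), x.2 + t * (y.2 - x.2))].

(* For x on the unit circle: the line through x orthogonal to the radius at x. *)
Definition tangent (R : realType) (x : R * R) : set (R * R) :=
  [set p | x.1 * (p.1 - x.1) + x.2 * (p.2 - x.2) = 0].

Definition aff (R : realType) (x y : circle R) : set (R * R) :=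
  if x == y then tangent (val x) else secant (val x) (val y).

Definition dist0 (R : realType) (L : set (R * R)) : R := inf (@enorm R @` L).

(* Two lines meet in a single point, coincide or are disjoint, so the last
   branch is the disjoint case. *)
Definition f (R : realType) (x1 x2 x3 x4 : circle R) : \bar R :=
  let L := aff x1 x2 in
  let M := aff x3 x4 in
  if `[< exists x0, L `&` M = [set x0] >] then
    (enorm (get [set x0 | L `&` M = [set x0]]))%:E
  else if `[< L = M >] then (dist0 L)%:E
  else +oo%E.

Definition prob_ell_lt (R : realType) (mu : probability (borel_circle R) R)
    (r : R) : \bar R :=
  (mu \x mu \x mu \x mu)%E
    [set x | (f x.1.1.1 x.1.1.2 x.1.2 x.2 < r%:E)%E].

(* Main.v *)
(* Of the three ways to pair four points of the circle, generically exactly one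
   gives chords that cross inside the disk, so the three probabilities, equal by
   symmetry, sum to 1 and the bound is 1/3 up to degenerate configurations. To gain
   the quadratic term, cut the circle into N = O(1/theta) cells so small that a
   chord meeting the disk of radius 1 - theta has its ends in different cells. With q_k the
   masses of the cells, counting coincidences of cells pointwise and integrating
   gives 3 P + 4 sum q_k^3 <= 1 + 3 (sum q_k^2)^2, and Cauchy-Schwarz together with
   sum q_k = 1 gives (sum q_k^2)^2 <= sum q_k^3 and sum q_k^2 >= 1/N. *)

Require Import Defs.
From mathcomp Require Import all_boot all_order all_algebra.
From mathcomp Require Import all_classical all_reals all_analysis.
From mathcomp Require Import measurable_realfun.
From mathcomp Require Import ring lra.

Set Implicit Arguments.
Unset Strict Implicit.
Unset Printing Implicit Defensive.

Import Order.TTheory GRing.Theory Num.Theory.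
Import numFieldNormedType.Exports.

Local Open Scope classical_set_scope.
Local Open Scope ring_scope.

(** * Points on chords of the unit circle *)

Section PlaneAlgebra.
Context {R : realType}.
Implicit Types p q : R * R.

Definition sqnorm p : R := p.1 ^+ 2 + p.2 ^+ 2.

Definition sqdist p q : R := (p.1 - q.1) ^+ 2 + (p.2 - q.2) ^+ 2.

Definition chord_point p q (t : R) : R * R :=
  (p.1 + t * (q.1 - p.1), p.2 + t * (q.2 - p.2)).

Lemma sqnorm_ge0 p : 0 <= sqnorm p.
Proof. by rewrite /sqnorm addr_ge0 ?sqr_ge0. Qed.

Lemma enorm_lt p (r : R) : 0 < r -> (enorm p < r) = (sqnorm p < r ^+ 2).
Proof.
move=> r0; rewrite /enorm -[in LHS](ger0_norm (ltW r0)) -sqrtr_sqr ltr_sqrt //.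
by rewrite exprn_gt0.
Qed.

Lemma sqdist_eq0 p q : (sqdist p q == 0) = (p == q).
Proof.
by case: p q => [a b] [c d]; rewrite /sqdist /= paddr_eq0 ?sqr_ge0 // !sqrf_eq0 !subr_eq0.
Qed.

Lemma sqdist_gt0 p q : p != q -> 0 < sqdist p q.
Proof.
by rewrite -sqdist_eq0 lt0r => ->; rewrite /sqdist addr_ge0 ?sqr_ge0.
Qed.

(** This is the power of a point: [1 - sqnorm] equals the product of the directed distances
    [t * |q - p|] and [(1 - t) * |q - p|] to the two ends of the chord. *)
Lemma sqnorm_chord_point p q t : sqnorm p = 1 -> sqnorm q = 1 ->
  sqnorm (chord_point p q t) = 1 - t * (1 - t) * sqdist p q.
Proof.
rewrite /sqnorm /sqdist /= => p1 q1.
have -> : (p.1 + t * (q.1 - p.1)) ^+ 2 + (p.2 + t * (q.2 - p.2)) ^+ 2 =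
  (1 - t) * (p.1 ^+ 2 + p.2 ^+ 2) + t * (q.1 ^+ 2 + q.2 ^+ 2)
  - t * (1 - t) * ((p.1 - q.1) ^+ 2 + (p.2 - q.2) ^+ 2) by ring.
by rewrite p1 q1; ring.
Qed.

(** Since [t * (1 - t) <= 1 / 4], a chord whose line enters the disk of radius [r] has squared
    length above [4 * (1 - r ^+ 2)]. This is how short chords are ruled out. *)
Lemma sqdist_chord_point p q t : sqnorm p = 1 -> sqnorm q = 1 ->
  4 * (1 - sqnorm (chord_point p q t)) <= sqdist p q.
Proof.
move=> p1 q1; rewrite sqnorm_chord_point//.
have : 0 <= (1 - 2 * t) ^+ 2 * sqdist p q.
  by rewrite mulr_ge0 ?sqr_ge0// /sqdist addr_ge0 ?sqr_ge0.
rewrite !expr2; nra.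
Qed.

Lemma chord_point_inside p q t : sqnorm p = 1 -> sqnorm q = 1 ->
  sqnorm (chord_point p q t) < 1 -> 0 < t < 1 /\ p != q.
Proof.
move=> p1 q1; rewrite sqnorm_chord_point// => lt1.
have d0 : 0 <= sqdist p q by rewrite /sqdist addr_ge0 ?sqr_ge0.
have tt : 0 < t * (1 - t).
  have : 0 < t * (1 - t) * sqdist p q by lra.
  by rewrite ltNge; apply: contraNT; rewrite -leNgt => h; rewrite mulr_le0_ge0.
split; first by nra.
by apply/eqP => pq; move: lt1; rewrite pq (eqP (_ : sqdist q q == 0)) ?sqdist_eq0//; lra.
Qed.

Lemma chord_point_on_circle p q t : sqnorm p = 1 -> sqnorm q = 1 -> p != q ->
  sqnorm (chord_point p q t) = 1 ->
  t = 0 /\ chord_point p q t = p \/ t = 1 /\ chord_point p q t = q.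
Proof.
move=> p1 q1 pq; rewrite sqnorm_chord_point// => e.
have /eqP : t * (1 - t) * sqdist p q = 0 by lra.
rewrite mulf_eq0 sqdist_eq0 (negbTE pq) orbF mulf_eq0 => /orP[/eqP t0|/eqP t1].
  by left; split=> //; rewrite /chord_point t0 !mul0r !addr0 -surjective_pairing.
have {}t1 : t = 1 by lra.
right; split=> //; rewrite /chord_point t1 !mul1r.
by rewrite [q in RHS]surjective_pairing; congr pair; ring.
Qed.

(* Eliminating the fourth point from two crossings puts the third on the line
   through the first two, and a line meets the circle in at most two points. *)
Lemma two_crossings p1 p2 p3 p4 (t s t' s' : R) :
  sqnorm p1 = 1 -> sqnorm p2 = 1 -> sqnorm p3 = 1 -> sqnorm p4 = 1 ->
  chord_point p1 p2 t = chord_point p3 p4 s ->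
  chord_point p1 p3 t' = chord_point p2 p4 s' ->
  sqnorm (chord_point p1 p2 t) < 1 -> sqnorm (chord_point p1 p3 t') < 1 ->
  p1 = p4 /\ p2 = p3.
Proof.
move=> n1 n2 n3 n4 e e' lt lt'.
have [/andP[t0 t1] d12] := chord_point_inside n1 n2 lt.
have [/andP[s0 s1] d34] := chord_point_inside n3 n4 (eq_ind _ (fun z => sqnorm z < 1) lt _ e).
have [/andP[t'0 t'1] d13] := chord_point_inside n1 n3 lt'.
have [/andP[s'0 s'1] d24] := chord_point_inside n2 n4 (eq_ind _ (fun z => sqnorm z < 1) lt' _ e').
have ks : 0 < s * t' + s' * (1 - s) by nra.
have ka : 0 < s * (1 - s') + s' * t by nra.
have ks0 : s * t' + s' * (1 - s) != 0 by rewrite gt_eqF.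
(* With [p1] as origin the crossings read [t p2 = (1 - s) p3 + s p4] and
   [t' p3 = (1 - s') p2 + s' p4]. Cancelling [s s' p4] gives [p3 = a p2]. As [a > 0], the point [p3]
   cannot be [p1], so it is [p2]. *)
set a := (s * (1 - s') + s' * t) / (s * t' + s' * (1 - s)).
have a0 : 0 < a by rewrite divr_gt0.
move: e e' => [ex ey] [ex' ey'].
have e3 : p3 = chord_point p1 p2 a.
  rewrite /chord_point [p3 in LHS]surjective_pairing /a; congr pair.
    have : (s * t' + s' * (1 - s)) * (p3.1 - p1.1) = (s * (1 - s') + s' * t) * (p2.1 - p1.1).
      by move: ex ex'; nra.
    by move=> h; rewrite mulrAC -h; field.
  have : (s * t' + s' * (1 - s)) * (p3.2 - p1.2) = (s * (1 - s') + s' * t) * (p2.2 - p1.2).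
    by move: ey ey'; nra.
  by move=> h; rewrite mulrAC -h; field.
have n3' := n3; rewrite e3 in n3'.
case: (chord_point_on_circle n1 n2 d12 n3') => [[a00 _]|[_ e32]].
  by rewrite a00 ltxx in a0.
have {e3 e32}e23 : p2 = p3 by rewrite e3 e32.
split=> //; subst p3.
(* Once [p3 = p2], the first crossing alone puts [p4] on the line through [p2] and [p1]. *)
have e4 : p4 = chord_point p2 p1 ((1 - t) / s).
  rewrite /chord_point [p4 in LHS]surjective_pairing; congr pair.
    have : s * (p4.1 - p2.1) = (1 - t) * (p1.1 - p2.1) by move: ex; nra.
    by move=> h; rewrite mulrAC -h; field; rewrite gt_eqF.
  have : s * (p4.2 - p2.2) = (1 - t) * (p1.2 - p2.2) by move: ey; nra.
  by move=> h; rewrite mulrAC -h; field; rewrite gt_eqF.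
have n4' := n4; rewrite e4 in n4'.
have d21 : p2 != p1 by rewrite eq_sym.
case: (chord_point_on_circle n2 n1 d21 n4') => [[_ e42]|[_ e41]].
  by move: d24; rewrite e4 e42 eqxx.
by rewrite e4 e41.
Qed.

End PlaneAlgebra.


(** * Geometry of the event that [f] is below [r] *)

Section Crossing.
Context {R : realType}.
Implicit Types (x y : circle R) (p q : R * R) (r t : R).

Lemma sqnorm_circle x : sqnorm (val x) = 1.
Proof.
have /set_mem := valP x; rewrite /unit_circle /= /enorm => h.
have := sqr_sqrtr (sqnorm_ge0 (val x)).
by rewrite /sqnorm h expr1n => <-.
Qed.

Lemma affC x y : aff x y = aff y x.
Proof.
rewrite /aff eq_sym; case: eqP => [->//|_].
apply/seteqP; split => p /= [t ->]; exists (1 - t); congr pair; ring.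
Qed.

(** By Pythagoras [sqnorm p = 1 + |p - x|^2] on the tangent, so pairs of equal points never
    contribute to [f < r] with [r <= 1]. *)
Lemma tangent_outside x p : tangent (val x) p -> 1 <= sqnorm p.
Proof.
have := sqnorm_circle x; rewrite /sqnorm /tangent /= => n1 tp.
have : 0 <= (p.1 - (val x).1) ^+ 2 + (p.2 - (val x).2) ^+ 2 by rewrite addr_ge0 ?sqr_ge0.
rewrite !expr2 in n1 *; nra.
Qed.

Lemma aff_inside x y p : aff x y p -> sqnorm p < 1 ->
  x != y /\ exists t, p = chord_point (val x) (val y) t.
Proof.
rewrite /aff; case: eqP => [_ /tangent_outside|_]; last by case=> t ->; split=> //; exists t.
by move=> h /(le_lt_trans h); rewrite ltxx.
Qed.

Lemma aff_secant x y t : x != y -> aff x y (chord_point (val x) (val y) t).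
Proof. by move=> xy; rewrite /aff (negbTE xy); exists t. Qed.

Lemma val_neq x y : x != y -> val x != val y.
Proof. by apply: contra_neq => /val_inj. Qed.

(* By Cramer's rule [cross_num p1 p2 p3 p4] is the determinant of [p2 - p1] and [p4 - p3] times
   the intersection point of the two secants. *)
Definition cross_den p1 p2 p3 p4 : R :=
  (p2.1 - p1.1) * (p4.2 - p3.2) - (p2.2 - p1.2) * (p4.1 - p3.1).

Definition cross_par p1 p3 p4 : R :=
  (p3.1 - p1.1) * (p4.2 - p3.2) - (p3.2 - p1.2) * (p4.1 - p3.1).

Definition cross_num p1 p2 p3 p4 : R * R :=
  (cross_den p1 p2 p3 p4 * p1.1 + cross_par p1 p3 p4 * (p2.1 - p1.1),
   cross_den p1 p2 p3 p4 * p1.2 + cross_par p1 p3 p4 * (p2.2 - p1.2)).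

(** A form of [f < r] for [0 < r <= 1] using only polynomial conditions on coordinates and
    equalities of points, from which measurability can be read off. Denominators are cleared in the
    first case. In the second the chords coincide, and the bound says that their midpoint, of
    squared norm [1 - sqdist p1 p2 / 4], lies in the disk of radius [r]. *)
Definition crosses_within r p1 p2 p3 p4 : Prop :=
  [/\ cross_den p1 p2 p3 p4 != 0
    & sqnorm (cross_num p1 p2 p3 p4) < r ^+ 2 * cross_den p1 p2 p3 p4 ^+ 2] \/
  (p1 = p3 /\ p2 = p4 \/ p1 = p4 /\ p2 = p3) /\ 4 * (1 - r ^+ 2) < sqdist p1 p2.

(** A uniform consequence of the two finite cases of [f]: when the lines coincide, an infimum below
    [r] still yields a point of the common line at distance below [r]. *)
Lemma f_lt_meet r (x1 x2 x3 x4 : circle R) : 0 < r -> (f x1 x2 x3 x4 < r%:E)%E ->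
  exists p, [/\ aff x1 x2 p, aff x3 x4 p & sqnorm p < r ^+ 2].
Proof.
move=> r0; rewrite /f; case: asboolP => [ex|_].
  have := getPex (P := [set x0 | aff x1 x2 `&` aff x3 x4 = [set x0]]) ex.
  set p := get _ => /= Lp; rewrite lte_fin enorm_lt// => pr.
  have [L M] : (aff x1 x2 `&` aff x3 x4) p by rewrite Lp.
  by exists p.
case: asboolP => [LM|_]; last by rewrite ltNge leey.
rewrite lte_fin /dist0 => /inf_lt.
case=> [|_ [p Lp <-]]; last by rewrite enorm_lt// => ?; exists p; rewrite -LM.
apply/image_nonempty; exists (val x1); rewrite /aff; case: eqP => _.
  by rewrite /tangent /=; ring.
by exists 0; rewrite !mul0r !addr0 -surjective_pairing.
Qed.

Lemma meet_crosses r (x1 x2 x3 x4 : circle R) p : r ^+ 2 <= 1 ->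
  aff x1 x2 p -> aff x3 x4 p -> sqnorm p < r ^+ 2 ->
  crosses_within r (val x1) (val x2) (val x3) (val x4).
Proof.
move=> r1 L M pr; have p1 := lt_le_trans pr r1.
have [/val_neq n12 [t e12]] := aff_inside L p1.
have [/val_neq n34 [s e34]] := aff_inside M p1.
have u1 := sqnorm_circle x1; have u2 := sqnorm_circle x2.
have u3 := sqnorm_circle x3; have u4 := sqnorm_circle x4.
move: n12 e12 n34 e34 u1 u2 u3 u4; rewrite /crosses_within.
move: (val x1) (val x2) (val x3) (val x4) => p1' p2' p3' p4' n12 e12 n34 e34 u1 u2 u3 u4.
have := e34; rewrite e12 => -[ex ey].
have [D0|D0] := eqVneq (cross_den p1' p2' p3' p4') 0; last first.
  left; split=> //.
  have -> : sqnorm (cross_num p1' p2' p3' p4') =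
      sqnorm p * cross_den p1' p2' p3' p4' ^+ 2.
    rewrite e12 /cross_num.
    have -> : cross_par p1' p3' p4' = t * cross_den p1' p2' p3' p4'.
      rewrite /cross_par /cross_den.
      have -> : p3'.1 - p1'.1 = t * (p2'.1 - p1'.1) - s * (p4'.1 - p3'.1) by lra.
      have -> : p3'.2 - p1'.2 = t * (p2'.2 - p1'.2) - s * (p4'.2 - p3'.2) by lra.
      ring.
    by rewrite /sqnorm /=; ring.
  by rewrite ltr_pM2r// exprn_even_gt0.
right; split; last first.
  have := sqdist_chord_point t u1 u2; rewrite -e12; apply: lt_le_trans.
  by lra.
have d12 := sqdist_gt0 n12.
(* The determinant vanishes, so [p4' - p3'] is parallel to [p2' - p1']; [c] is the ratio, obtained
   by orthogonal projection. *)
set c := ((p1'.1 - p2'.1) * (p3'.1 - p4'.1) + (p1'.2 - p2'.2) * (p3'.2 - p4'.2))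
   / sqdist p1' p2'.
have v1 : p4'.1 - p3'.1 = c * (p2'.1 - p1'.1).
  have : sqdist p1' p2' * (p4'.1 - p3'.1) = c * sqdist p1' p2' * (p2'.1 - p1'.1)
     - cross_den p1' p2' p3' p4' * (p2'.2 - p1'.2).
    by rewrite /c divfK ?gt_eqF// /sqdist /cross_den; ring.
  rewrite D0 mul0r subr0 mulrAC mulrC => /(mulIf _); apply; exact: lt0r_neq0.
have v2 : p4'.2 - p3'.2 = c * (p2'.2 - p1'.2).
  have : sqdist p1' p2' * (p4'.2 - p3'.2) = c * sqdist p1' p2' * (p2'.2 - p1'.2)
     + cross_den p1' p2' p3' p4' * (p2'.1 - p1'.1).
    by rewrite /c divfK ?gt_eqF// /sqdist /cross_den; ring.
  rewrite D0 mul0r addr0 mulrAC mulrC => /(mulIf _); apply; exact: lt0r_neq0.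
have e3 : p3' = chord_point p1' p2' (t - s * c).
  rewrite [LHS]surjective_pairing /chord_point; congr pair.
    by move: ex; rewrite v1; lra.
  by move: ey; rewrite v2; lra.
have e4 : p4' = chord_point p1' p2' (t - s * c + c).
  rewrite [LHS]surjective_pairing /chord_point; congr pair.
    by move: ex; rewrite v1; lra.
  by move: ey; rewrite v2; lra.
(* The common point puts [p3'] and [p4'] on the line through [p1'] and [p2']; being on the circle,
   each is one of these two, and they differ. *)
have u3' := u3; have u4' := u4; rewrite e3 in u3'; rewrite e4 in u4'.
case: (chord_point_on_circle u1 u2 n12 u3') => -[_ E3];
case: (chord_point_on_circle u1 u2 n12 u4') => -[_ E4];
  move: n34; rewrite e3 E3 e4 E4 ?eqxx// => _; by [left|right].
Qed.

Lemma crosses_lt_f r (x1 x2 x3 x4 : circle R) : 0 < r <= 1 ->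
  crosses_within r (val x1) (val x2) (val x3) (val x4) -> (f x1 x2 x3 x4 < r%:E)%E.
Proof.
move=> /andP[r0 r1]; rewrite /f.
have r21 : r ^+ 2 <= 1 by rewrite expr_le1// ltW.
case=> [[D0 lt]|[eqs lt]].
  have n12 : x1 != x2.
    by apply: contra_neq D0 => ->; rewrite /cross_den; ring.
  have n34 : x3 != x4.
    by apply: contra_neq D0 => ->; rewrite /cross_den; ring.
  rewrite /aff (negbTE n12) (negbTE n34).
  set p1 := val x1 in D0 lt *; set p2 := val x2 in D0 lt *.
  set p3 := val x3 in D0 lt *; set p4 := val x4 in D0 lt *.
  set D := cross_den p1 p2 p3 p4 in D0 lt *.
  set p0 := ((cross_num p1 p2 p3 p4).1 / D, (cross_num p1 p2 p3 p4).2 / D).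
  have LM : secant p1 p2 `&` secant p3 p4 = [set p0].
    apply/seteqP; split=> [p /= [[t ->] [s [ex ey]]]|_ ->].
      have tD : cross_par p1 p3 p4 = t * D.
        rewrite /cross_par /D /cross_den.
        have -> : p3.1 - p1.1 = t * (p2.1 - p1.1) - s * (p4.1 - p3.1) by lra.
        have -> : p3.2 - p1.2 = t * (p2.2 - p1.2) - s * (p4.2 - p3.2) by lra.
        ring.
      by rewrite /p0 /cross_num -/D tD /=; congr pair; field.
    split.
      exists (cross_par p1 p3 p4 / D).
      by rewrite /p0 /cross_num -/D /=; congr pair; field.
    (* Exchanging the two lines changes the sign of the determinant. *)
    exists (- cross_par p3 p1 p2 / D).
    rewrite /p0 /cross_num -/D /= /cross_par; congr pair;
      rewrite /D /cross_den; field; exact: D0.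
  case: asboolP => [ex|[]]; last by exists p0.
  have := getPex (P := [set x0 | secant p1 p2 `&` secant p3 p4 = [set x0]]) ex.
  set p := get _ => /= Lp; rewrite lte_fin enorm_lt//.
  have -> : p = p0 by have : [set p0] p by rewrite -LM Lp.
  have -> : sqnorm p0 = sqnorm (cross_num p1 p2 p3 p4) / D ^+ 2.
    by rewrite /p0 /sqnorm /=; field.
  by rewrite ltr_pdivrMr// exprn_even_gt0.
have d12 : 0 < sqdist (val x1) (val x2) by apply: le_lt_trans lt; nra.
have n12 : x1 != x2.
  by apply: contraTneq d12 => ->; rewrite (eqP (_ : sqdist _ _ == 0)) ?ltxx ?sqdist_eq0.
have LM : aff x1 x2 = aff x3 x4.
  by case: eqs => -[/val_inj -> /val_inj ->] //; rewrite affC.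
(* A secant is not a single point, as its parameters [0] and [1] give distinct points; so the first
   branch of [f] is excluded. *)
rewrite -LM setIid; case: asboolP => [[p0 Lp]|_].
  have : forall t, chord_point (val x1) (val x2) t = p0.
    by move=> t; have := aff_secant t n12; rewrite Lp.
  move=> h; have := h 0; rewrite -(h 1) => -[].
  rewrite !mul0r !mul1r !addr0 => e1 e2.
  move/eqP: n12; case; apply/val_inj.
  rewrite [LHS]surjective_pairing [RHS]surjective_pairing; congr pair; lra.
case: asboolP => // _.
rewrite lte_fin /dist0.
(* The midpoint of the chord bounds the distance from the line to the origin. *)
apply: (@le_lt_trans _ _ (enorm (chord_point (val x1) (val x2) (1 / 2)))).
  apply: ge_inf; first by exists 0 => _ [p _ <-]; exact: sqrtr_ge0.
  by exists (chord_point (val x1) (val x2) (1 / 2)) => //; exact: aff_secant.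
rewrite enorm_lt// sqnorm_chord_point ?sqnorm_circle//.
rewrite !expr2 in lt *; lra.
Qed.

Lemma f_ltE r (x1 x2 x3 x4 : circle R) (H : 0 < r <= 1) :
  (f x1 x2 x3 x4 < r%:E)%E <-> crosses_within r (val x1) (val x2) (val x3) (val x4).
Proof.
split; last exact: crosses_lt_f.
case/andP: H => r0 r1 /(f_lt_meet r0)[p [L M pr]].
by apply: meet_crosses L M pr; rewrite expr_le1// ltW.
Qed.

Lemma f_lt_chord_long r (x1 x2 x3 x4 : circle R) : 0 < r -> r <= 1 ->
  (f x1 x2 x3 x4 < r%:E)%E ->
  4 * (1 - r ^+ 2) < sqdist (val x1) (val x2) /\
  4 * (1 - r ^+ 2) < sqdist (val x3) (val x4).
Proof.
move=> r0 r1 /(f_lt_meet r0)[p [L M pr]].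
have p1 : sqnorm p < 1 by apply: lt_le_trans pr _; rewrite expr_le1// ltW.
have [_ [t e12]] := aff_inside L p1; have [_ [s e34]] := aff_inside M p1.
have := sqdist_chord_point t (sqnorm_circle x1) (sqnorm_circle x2); rewrite -e12.
have := sqdist_chord_point s (sqnorm_circle x3) (sqnorm_circle x4); rewrite -e34.
by move=> h34 h12; split; lra.
Qed.

Lemma f_lt_two_pairings r (x1 x2 x3 x4 : circle R) : 0 < r -> r <= 1 ->
  (f x1 x2 x3 x4 < r%:E)%E -> (f x1 x3 x2 x4 < r%:E)%E -> x1 = x4 /\ x2 = x3.
Proof.
move=> r0 r1 /(f_lt_meet r0)[p [L M pr]] /(f_lt_meet r0)[q [L' M' qr]].
have p1 : sqnorm p < 1 by apply: lt_le_trans pr _; rewrite expr_le1// ltW.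
have q1 : sqnorm q < 1 by apply: lt_le_trans qr _; rewrite expr_le1// ltW.
have [_ [t e12]] := aff_inside L p1; have [_ [s e34]] := aff_inside M p1.
have [_ [t' e13]] := aff_inside L' q1; have [_ [s' e24]] := aff_inside M' q1.
have [] := @two_crossings _ (val x1) (val x2) (val x3) (val x4) t s t' s';
  rewrite ?sqnorm_circle -?e12 -?e13//.
by move=> /val_inj -> /val_inj ->.
Qed.

End Crossing.


(** * Coordinate exchanges and integration of indicators on product spaces *)

Section Exchange.
Context {R : realType} {d d' : measure_display}.
Context {W : measurableType d'} {T : measurableType d}.
Variables (nu : probability W R) (m : probability T R).
Local Open Scope ereal_scope.

Definition swap_last (V U : Type) (z : V * U * U) : V * U * U :=
  (z.1.1, z.2, z.1.2).

Lemma measurable_swap_last : measurable_fun setT (@swap_last W T).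
Proof.
apply: measurable_fun_pair => /=; last exact: measurableT_comp.
by apply: measurable_fun_pair => //=; exact: measurableT_comp.
Qed.

(** Both sides become iterated integrals; for each fixed first coordinate, Tonelli's theorem
    exchanges the two inner ones. *)
Lemma integral_swap_last (h : W * T * T -> \bar R) :
  measurable_fun setT h -> (forall z, 0 <= h z) ->
  \int[nu \x m \x m]_z h (swap_last z) = \int[nu \x m \x m]_z h z.
Proof.
move=> mh h0.
have iter (g : W * T * T -> \bar R) : measurable_fun setT g -> (forall z, 0 <= g z) ->
    \int[nu \x m \x m]_z g z = \int[nu]_w \int[m]_y \int[m]_z g (w, y, z).
  move=> mg g0; rewrite (fubini_tonelli1 (m1 := (nu \x m : probability _ R)) g mg g0).
  rewrite (fubini_tonelli1 (fubini_F m g))//; first exact: measurable_fun_fubini_tonelli_F.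
  by move=> z; exact: integral_ge0.
rewrite (iter h mh h0).
have msh : measurable_fun setT (h \o @swap_last W T).
  by apply: (measurableT_comp mh); exact: measurable_swap_last.
rewrite (iter _ msh (fun z => h0 (swap_last z))).
apply: eq_integral => w _; rewrite /swap_last /=.
have mhw : measurable_fun setT (fun yz : T * T => h (w, yz.1, yz.2)).
  apply: (measurableT_comp mh); apply: measurable_fun_pair => //=.
  exact: measurable_fun_pair.
exact: (esym (fubini_tonelli (fun yz : T * T => h (w, yz.1, yz.2)) mhw (fun z => h0 _))).
Qed.

Lemma measure_swap_last (A : set (W * T * T)) : measurable A ->
  (nu \x m \x m) (@swap_last W T @^-1` A) = (nu \x m \x m) A.
Proof.
move=> mA.
have mB : measurable (@swap_last W T @^-1` A).
  by rewrite -[X in measurable X]setTI; exact: measurable_swap_last.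
have m1A : measurable_fun setT (EFin \o (\1_A : W * T * T -> R)).
  by apply/measurable_EFinP; exact: measurable_indic.
have := integral_swap_last m1A (fun z => _ : 0 <= _).
rewrite (integral_indic _ measurableT mA) setIT => <-; last first.
  by move=> z; rewrite lee_fin.
by rewrite -[in LHS](setIT (_ @^-1` _)) -(integral_indic _ measurableT mB).
Qed.

(* The measure on the product with [U] integrates the measures of sections, so
   this is [integral_swap_last] for the function sending [z] to the [k]-measure
   of the section of [A] at [z]. *)
Lemma measure_swap_inner {d2} {U : measurableType d2} (k : probability U R)
    (A : set (W * T * T * U)) : measurable A ->
  (nu \x m \x m \x k) [set z | A (swap_last z.1, z.2)] = (nu \x m \x m \x k) A.
Proof.
move=> mA; have mk := measurable_fun_xsection k mA.
exact: integral_swap_last mk (fun _ => measure_ge0 _ _).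
Qed.

End Exchange.


(** Integrating the pointwise inequality of indicator sums turns a counting statement about
    configurations into one about probabilities. *)
Lemma le_sum_measure {R : realType} {d} {T : measurableType d}
    (mu : {measure set T -> \bar R}) (As Bs : seq (set T)) :
  {in As, forall A, measurable A} -> {in Bs, forall B, measurable B} ->
  (forall x, \sum_(A <- As) \1_A x <= \sum_(B <- Bs) \1_B x :> R) ->
  (\sum_(A <- As) mu A <= \sum_(B <- Bs) mu B)%E.
Proof.
pose S (Cs : seq (set T)) (x : T) : R := \sum_(C <- Cs) \1_C x.
have intE Cs : {in Cs, forall C, measurable C} ->
    measurable_fun setT (EFin \o S Cs) /\
    (\sum_(C <- Cs) mu C = \int[mu]_x (S Cs x)%:E)%E.
  elim: Cs => [|C Cs IH] mC.
    have -> : S [::] = cst 0 by apply: funext => x; rewrite /S big_nil.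
    by rewrite big_nil integral0; split => //; apply/measurable_EFinP.
  have mC1 : measurable C by apply: mC; rewrite inE eqxx.
  have [|mS eS] := IH; first by move=> D DC; apply: mC; rewrite inE DC orbT.
  have m1 : measurable_fun setT (EFin \o (\1_C : T -> R)).
    by apply/measurable_EFinP; exact: measurable_indic.
  have SE : EFin \o S (C :: Cs) = (fun x => (\1_C x)%:E + (S Cs x)%:E)%E.
    by apply: funext => x; rewrite /S /= big_cons EFinD.
  split; first by rewrite SE; exact: emeasurable_funD.
  rewrite big_cons eS -[RHS]/(\int[mu]_x (EFin \o S (C :: Cs)) x)%E SE ge0_integralD//.
  - by rewrite integral_indic// setIT.
  - by move=> x _; rewrite lee_fin sumr_ge0.
move=> mA mB le; have [mSA ->] := intE _ mA; have [mSB ->] := intE _ mB.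
apply: (@ge0_le_integral _ _ _ mu _ measurableT (EFin \o S As) (EFin \o S Bs)) => // x _.
  by rewrite lee_fin sumr_ge0.
exact: le.
Qed.

Section FourfoldProduct.
Context {R : realType} {d : measure_display} {T : measurableType d}.
Variable mu : probability T R.
Local Open Scope ereal_scope.

Definition box4 (A1 A2 A3 A4 : set T) : set (T * T * T * T) :=
  A1 `*` A2 `*` A3 `*` A4.

Lemma measurable_box4 A1 A2 A3 A4 : measurable A1 -> measurable A2 ->
  measurable A3 -> measurable A4 -> measurable (box4 A1 A2 A3 A4).
Proof. by move=> *; do 3 apply: measurableX => //. Qed.

Lemma measure_box4 A1 A2 A3 A4 : measurable A1 -> measurable A2 ->
  measurable A3 -> measurable A4 ->
  (mu \x mu \x mu \x mu) (box4 A1 A2 A3 A4) = mu A1 * mu A2 * mu A3 * mu A4.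
Proof.
move=> m1 m2 m3 m4.
have m12 : measurable (A1 `*` A2) by exact: measurableX.
have m123 : measurable (A1 `*` A2 `*` A3) by exact: measurableX.
have -> : (mu \x mu \x mu \x mu) (box4 A1 A2 A3 A4) =
    (mu \x mu \x mu) (A1 `*` A2 `*` A3) * mu A4.
  exact: (product_measure1E (mu \x mu \x mu : probability _ R) mu m123 m4).
have -> : (mu \x mu \x mu) (A1 `*` A2 `*` A3) = (mu \x mu) (A1 `*` A2) * mu A3.
  exact: (product_measure1E (mu \x mu : probability _ R) mu m12 m3).
by rewrite (product_measure1E mu mu m1 m2).
Qed.
End FourfoldProduct.


(** * Counting coincidences of cells, and power sums *)

(** Here [a], [b], [e], [h] are the cells of the four points and [g1], [g2], [g3] tell whether the
    pairings 12|34, 13|24, 14|23 cross. If all cells agree, no pairing crosses and both sides are 4.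
    If exactly three agree, none crosses and both sides are 1. For two pairs of equal cells two
    pairings may cross, but the right side is 2. Otherwise at most one crosses. *)
Lemma count_coincidences (K : eqType) (a b e h : K) (g1 g2 g3 : bool) :
  (g1 -> (a != b) && (e != h)) -> (g2 -> (a != e) && (b != h)) ->
  (g3 -> (a != h) && (b != e)) ->
  (g1 -> g2 -> (a == h) && (b == e)) -> (g1 -> g3 -> (a == e) && (b == h)) ->
  (g2 -> g3 -> (a == b) && (e == h)) ->
  (g1 + (g2 + g3) + (((a == b) && (a == e)) + ((a == b) && (a == h))
     + ((a == e) && (a == h)) + ((b == e) && (b == h)))
   <= 1 + (((a == b) && (e == h)) + ((a == e) && (b == h))
     + ((a == h) && (b == e))))%N.
Proof.
(* These instances of transitivity are enough to treat the six equalities as free booleans and check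
   all cases. *)
have : (a == b) ==> ((a == e) == (b == e)) && ((a == h) == (b == h)).
  by apply/implyP => /eqP ->; rewrite !eqxx.
have : (a == e) ==> ((a == b) == (b == e)) && ((a == h) == (e == h)).
  by apply/implyP => /eqP ->; rewrite (eq_sym e b) !eqxx.
have : (a == h) ==> ((a == b) == (b == h)) && ((a == e) == (e == h)).
  by apply/implyP => /eqP ->; rewrite (eq_sym h b) (eq_sym h e) !eqxx.
have : (b == e) ==> ((b == h) == (e == h)) by apply/implyP => /eqP ->.
have : (b == h) ==> ((b == e) == (e == h)).
  by apply/implyP => /eqP ->; rewrite (eq_sym h e).
move: (a == b) (a == e) (a == h) (b == e) (b == h) (e == h).
by case: g1; case: g2; case: g3; move=> [] [] [] [] [] [] //=; do ?[move=> /(_ isT) // | move=> _ //].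
Qed.

(** With [s2] and [s3] the sums of squares and cubes, [3 p <= 1 + 3 s2^2 - 4 s3 <= 1 - s2^2 <= 1 - 1
    / N^2]. *)
Lemma power_sums_bound (R : realFieldType) (N : nat) (q : 'I_N -> R) (p : R) :
  (forall k, 0 <= q k) -> \sum_k q k = 1 ->
  3 * p + 4 * (\sum_k q k ^+ 3) <= 1 + 3 * (\sum_k q k ^+ 2) ^+ 2 ->
  p <= 1 / 3 - 1 / (3 * N%:R ^+ 2).
Proof.
move=> q0 q1.
set s3 := \sum_k _; set s2 := \sum_k _ => hp.
have N0 : (0 < N)%N.
  by case: N q q0 q1 {s2 s3 hp} => // q _; rewrite big_ord0 => /eqP; rewrite eq_sym oner_eq0.
have nN0 : 0 < N%:R :> R by rewrite ltr0n.
have s23 : s2 ^+ 2 <= s3.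
  rewrite -subr_ge0.
  (* The difference is the variance of the values [q k] taken with weights [q k]. *)
  have -> : s3 - s2 ^+ 2 = \sum_k q k * (q k - s2) ^+ 2.
    have -> : \sum_k q k * (q k - s2) ^+ 2 =
        \sum_k (q k ^+ 3 - (2 * s2) * q k ^+ 2 + s2 ^+ 2 * q k).
      by apply: eq_bigr => k _; ring.
    by rewrite big_split /= sumrB -!mulr_sumr q1 -/s2 -/s3; ring.
  by apply: sumr_ge0 => k _; rewrite mulr_ge0 ?sqr_ge0.
have s2N : N%:R^-1 <= s2.
  rewrite -subr_ge0.
  have -> : s2 - N%:R^-1 = \sum_k (q k - N%:R^-1) ^+ 2.
    have -> : \sum_k (q k - N%:R^-1) ^+ 2 =
        \sum_k (q k ^+ 2 - (2 * N%:R^-1) * q k + N%:R^-1 ^+ 2).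
      by apply: eq_bigr => k _; ring.
    rewrite big_split /= sumrB -mulr_sumr q1 -/s2 sumr_const card_ord -mulr_natl.
    by field; rewrite gt_eqF.
  by apply: sumr_ge0 => k _; rewrite sqr_ge0.
have sN : N%:R^-1 ^+ 2 <= s2 ^+ 2.
  have i0 : 0 <= N%:R^-1 :> R by rewrite invr_ge0 ltW.
  by apply: lerXn2r; rewrite ?nnegrE//; exact: le_trans i0 s2N.
have -> : 1 / (3 * N%:R ^+ 2) = N%:R^-1 ^+ 2 / 3 :> R by field; rewrite gt_eqF.
lra.
Qed.

(** * The probability bound for an abstract pairing event *)

Section PairingBound.
Context {R : realType} {d : measure_display} {T : measurableType d}.
Variables (mu : probability T R) (N : nat) (c : T -> 'I_N) (F : set (T * T * T * T)).
Hypothesis mc : forall k, measurable (c @^-1` [set k]).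
Hypothesis mF : measurable F.
Hypothesis Fsym : forall x1 x2 x3 x4, F (x1, x2, x3, x4) -> F (x1, x2, x4, x3).
Hypothesis Fcells : forall x1 x2 x3 x4, F (x1, x2, x3, x4) ->
  c x1 != c x2 /\ c x3 != c x4.
Hypothesis Fexcl : forall x1 x2 x3 x4, F (x1, x2, x3, x4) -> F (x1, x3, x2, x4) ->
  c x1 = c x4 /\ c x2 = c x3.

Let A k : set T := c @^-1` [set k].
Let q k : R := fine (mu (A k)).
(** [F] concerns the pairing 12|34. Unfolding the swaps, [F2] is [F (x1, x3, x2, x4)] and [F3] is
    [F (x1, x4, x2, x3)], the other two pairings. *)
Let F2 : set (T * T * T * T) := [set z | F (swap_last z.1, z.2)].
Let F3 : set (T * T * T * T) := [set z | F2 (swap_last z)].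

Let muA k : mu (A k) = (q k)%:E.
Proof. by rewrite /q fineK//; apply: fin_num_measure; exact: mc. Qed.

Let q_ge0 k : 0 <= q k. Proof. by apply: fine_ge0; exact: measure_ge0. Qed.

Let inA x k : (x \in A k) = (c x == k).
Proof. by apply/idP/eqP => [/set_mem|h]; [|apply/mem_set]. Qed.

Let sum_cell (K : finType) (i : K) (P : pred K) :
  \sum_k ((i == k) && P k)%:R = (P i)%:R :> R.
Proof.
by rewrite (bigD1 i)//= eqxx big1 ?addr0// => k; rewrite eq_sym => /negbTE ->.
Qed.

(** The cells partition [T], so their indicators sum to that of [setT]; [le_sum_measure] is applied
    in both directions. *)
Let sum_q : \sum_k q k = 1.
Proof.
pose cells := [seq A k | k <- index_enum 'I_N].
have mcells : {in cells, forall B, measurable B} by move=> _ /mapP[k _ ->]; exact: mc.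
have mT : {in [:: [set: T]], forall B, measurable B}.
  by move=> B; rewrite inE => /eqP ->; exact: measurableT.
have cellsE x : \sum_(B <- cells) \1_B x = \sum_(B <- [:: [set: T]]) \1_B x :> R.
  rewrite big_map big_seq1 indicE in_setT -(sum_cell (c x) predT).
  by apply: eq_bigr => k _; rewrite indicE inA andbT.
apply/EFin_inj; rewrite -(probability_setT mu) -sumEFin.
have -> : (\sum_k (q k)%:E = \sum_(B <- cells) mu B)%E.
  by rewrite big_map; apply: eq_bigr => k _; rewrite muA.
have -> : (mu [set: T] = \sum_(B <- [:: [set: T]]) mu B)%E by rewrite big_seq1.
by apply/eqP; rewrite eq_le !le_sum_measure// => x; rewrite cellsE.
Qed.

Let mF2 : measurable F2.
Proof.
have m2 : measurable_fun setT (fun z : T * T * T * T => (swap_last z.1, z.2)).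
  apply: measurable_fun_pair => //.
  by apply: (measurableT_comp (@measurable_swap_last _ _ T T)).
by rewrite -[F2]setTI; exact: m2.
Qed.

Let mF3 : measurable F3.
Proof. by rewrite -[F3]setTI; exact: measurable_swap_last. Qed.

Let indic_box4 (A1 A2 A3 A4 : set T) x1 x2 x3 x4 :
  \1_(box4 A1 A2 A3 A4) (x1, x2, x3, x4) =
  ((x1 \in A1) && ((x2 \in A2) && ((x3 \in A3) && (x4 \in A4))))%:R :> R.
Proof. by rewrite indicE /box4 !in_setX /= -!andbA. Qed.

(* The indicators of the sets in [As] and [Bs] add up to the two sides of
   [count_coincidences]. *)
Let As := [:: F; F2; F3] ++ [seq box4 (A k) (A k) (A k) setT | k <- index_enum 'I_N]
  ++ [seq box4 (A k) (A k) setT (A k) | k <- index_enum 'I_N]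
  ++ [seq box4 (A k) setT (A k) (A k) | k <- index_enum 'I_N]
  ++ [seq box4 setT (A k) (A k) (A k) | k <- index_enum 'I_N].

Let kk := index_enum ('I_N * 'I_N)%type.

Let Bs := [:: setT] ++ [seq box4 (A k.1) (A k.1) (A k.2) (A k.2) | k <- kk]
  ++ [seq box4 (A k.1) (A k.2) (A k.1) (A k.2) | k <- kk]
  ++ [seq box4 (A k.1) (A k.2) (A k.2) (A k.1) | k <- kk].

Let measurable_cat (Xs Ys : seq (set (T * T * T * T))) :
  {in Xs, forall B, measurable B} -> {in Ys, forall B, measurable B} ->
  {in Xs ++ Ys, forall B, measurable B}.
Proof. by move=> mX mY B; rewrite mem_cat => /orP[/mX|/mY]. Qed.

Let measurable_map (K : eqType) (s : seq K) (G : K -> set (T * T * T * T)) :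
  (forall k, measurable (G k)) -> {in [seq G k | k <- s], forall B, measurable B}.
Proof. by move=> mG _ /mapP[k _ ->]. Qed.

Let mAs : {in As, forall B, measurable B}.
Proof.
apply: measurable_cat; first by move=> B; rewrite !inE => /or3P[]/eqP->.
do 3 (apply: measurable_cat; first by
  apply: measurable_map => k; apply: measurable_box4 => //; exact: mc).
by apply: measurable_map => k; apply: measurable_box4 => //; exact: mc.
Qed.

Let mBs : {in Bs, forall B, measurable B}.
Proof.
apply: measurable_cat; first by move=> B; rewrite inE => /eqP->; exact: measurableT.
do 2 (apply: measurable_cat; first by
  apply: measurable_map => k; apply: measurable_box4; exact: mc).
by apply: measurable_map => k; apply: measurable_box4; exact: mc.
Qed.

Let le_indic (x : T * T * T * T) :
  \sum_(B <- As) \1_B x <= \sum_(B <- Bs) \1_B x :> R.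
Proof.
case: x => [[[x1 x2] x3] x4]; set x := (x1, x2, x3, x4).
rewrite /As /Bs !big_cat !big_map !big_cons !big_nil /=.
have -> : \sum_k \1_(box4 (A k) (A k) (A k) setT) x =
    ((c x1 == c x2) && (c x1 == c x3))%:R :> R.
  under eq_bigr do rewrite indic_box4 !inA in_setT andbT.
  by rewrite (sum_cell (c x1) (fun k => (c x2 == k) && (c x3 == k))) !(eq_sym _ (c x1)).
have -> : \sum_k \1_(box4 (A k) (A k) setT (A k)) x =
    ((c x1 == c x2) && (c x1 == c x4))%:R :> R.
  under eq_bigr do rewrite indic_box4 !inA in_setT /=.
  by rewrite (sum_cell (c x1) (fun k => (c x2 == k) && (c x4 == k))) !(eq_sym _ (c x1)).
have -> : \sum_k \1_(box4 (A k) setT (A k) (A k)) x =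
    ((c x1 == c x3) && (c x1 == c x4))%:R :> R.
  under eq_bigr do rewrite indic_box4 !inA in_setT /=.
  by rewrite (sum_cell (c x1) (fun k => (c x3 == k) && (c x4 == k))) !(eq_sym _ (c x1)).
have -> : \sum_k \1_(box4 setT (A k) (A k) (A k)) x =
    ((c x2 == c x3) && (c x2 == c x4))%:R :> R.
  under eq_bigr do rewrite indic_box4 !inA in_setT /=.
  by rewrite (sum_cell (c x2) (fun k => (c x3 == k) && (c x4 == k))) !(eq_sym _ (c x2)).
have -> : \sum_(k : 'I_N * 'I_N) \1_(box4 (A k.1) (A k.1) (A k.2) (A k.2)) x =
    ((c x1 == c x2) && (c x3 == c x4))%:R :> R.
  (* Only the index formed by the cells of [x1] and [x3] can contribute; the other two double sums
     are treated alike. *)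
  rewrite (eq_sym (c x1)) (eq_sym (c x3)).
  rewrite -(sum_cell (c x1, c x3) (fun k => (c x2 == k.1) && (c x4 == k.2))).
  apply: eq_bigr => -[k l] _; rewrite indic_box4 !inA xpair_eqE /=.
  by do 4 case: (_ == _).
have -> : \sum_(k : 'I_N * 'I_N) \1_(box4 (A k.1) (A k.2) (A k.1) (A k.2)) x =
    ((c x1 == c x3) && (c x2 == c x4))%:R :> R.
  rewrite (eq_sym (c x1)) (eq_sym (c x2)).
  rewrite -(sum_cell (c x1, c x2) (fun k => (c x3 == k.1) && (c x4 == k.2))).
  apply: eq_bigr => -[k l] _; rewrite indic_box4 !inA xpair_eqE /=.
  by do 4 case: (_ == _).
have -> : \sum_(k : 'I_N * 'I_N) \1_(box4 (A k.1) (A k.2) (A k.2) (A k.1)) x =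
    ((c x1 == c x4) && (c x2 == c x3))%:R :> R.
  rewrite (eq_sym (c x1)) (eq_sym (c x2)).
  rewrite -(sum_cell (c x1, c x2) (fun k => (c x4 == k.1) && (c x3 == k.2))).
  apply: eq_bigr => -[k l] _; rewrite indic_box4 !inA xpair_eqE /=.
  by do 4 case: (_ == _).
rewrite !indicE in_setT.
have E1 : x \in F -> F (x1, x2, x3, x4) by move/set_mem.
have E2 : x \in F2 -> F (x1, x3, x2, x4) by move/set_mem.
have E3 : x \in F3 -> F (x1, x4, x2, x3) by move/set_mem.
have h1 : x \in F -> (c x1 != c x2) && (c x3 != c x4).
  by move=> /E1 h; apply/andP; exact: Fcells h.
have h2 : x \in F2 -> (c x1 != c x3) && (c x2 != c x4).
  by move=> /E2 h; apply/andP; exact: Fcells h.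
have h3 : x \in F3 -> (c x1 != c x4) && (c x2 != c x3).
  by move=> /E3 h; apply/andP; exact: Fcells h.
have h12 : x \in F -> x \in F2 -> (c x1 == c x4) && (c x2 == c x3).
  by move=> /E1 h /E2 h'; have [-> ->] := Fexcl h h'; rewrite !eqxx.
have h13 : x \in F -> x \in F3 -> (c x1 == c x3) && (c x2 == c x4).
  (* [Fsym] rewrites 12|34 as 12|43, so that [Fexcl] compares it with 14|23; in [h23] both events
     are rewritten. *)
  by move=> /E1 h /E3 h'; have [-> ->] := Fexcl (Fsym h) h'; rewrite !eqxx.
have h23 : x \in F2 -> x \in F3 -> (c x1 == c x2) && (c x3 == c x4).
  by move=> /E2 h /E3 h'; have [-> ->] := Fexcl (Fsym h) (Fsym h'); rewrite !eqxx.
have := count_coincidences h1 h2 h3 h12 h13 h23.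
by rewrite -(ler_nat R) !natrD !addr0 !addrA.
Qed.

Let P4 : probability _ R := (mu \x mu \x mu \x mu)%E.

Let cube_sum A1 A2 A3 A4 :
  (forall k, measurable (A1 k)) -> (forall k, measurable (A2 k)) ->
  (forall k, measurable (A3 k)) -> (forall k, measurable (A4 k)) ->
  (forall k, mu (A1 k) * mu (A2 k) * mu (A3 k) * mu (A4 k) = (q k ^+ 3)%:E)%E ->
  (\sum_(k : 'I_N) P4 (box4 (A1 k) (A2 k) (A3 k) (A4 k)) = (\sum_k q k ^+ 3)%:E)%E.
Proof.
move=> m1 m2 m3 m4 e; rewrite -sumEFin; apply: eq_bigr => k _.
by rewrite -e; exact: measure_box4.
Qed.

(** Summing over pairs of cells expands the square of the sum of [q k ^+ 2]; the maps [a1] to [a4]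
    cover the three ways of placing two cells twice each. *)
Let square_sum (a1 a2 a3 a4 : 'I_N * 'I_N -> 'I_N) :
  (forall k, q (a1 k) * q (a2 k) * q (a3 k) * q (a4 k) = q k.1 ^+ 2 * q k.2 ^+ 2) ->
  (\sum_k P4 (box4 (A (a1 k)) (A (a2 k)) (A (a3 k)) (A (a4 k))) =
    ((\sum_k q k ^+ 2) ^+ 2)%:E)%E.
Proof.
move=> e; rewrite [in RHS]expr2 big_distrlr /=.
rewrite (pair_bigA _ (fun i j => q i ^+ 2 * q j ^+ 2)) /= -sumEFin.
apply: eq_bigr => k _; rewrite -e !EFinM -!muA; apply: measure_box4; exact: mc.
Qed.

Lemma pairing_bound :
  ((mu \x mu \x mu \x mu) F <= (1 / 3 - 1 / (3 * N%:R ^+ 2))%:E)%E.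
Proof.
have P2 : P4 F2 = P4 F by exact: (measure_swap_inner mu mu mu mF).
have P3 : P4 F3 = P4 F.
  rewrite -P2; exact: (measure_swap_last (mu \x mu : probability _ R)%E mu mF2).
have PF : P4 F = (fine (P4 F))%:E by rewrite fineK// fin_num_measure.
rewrite -/(P4 F) PF lee_fin.
apply: (power_sums_bound q_ge0 sum_q).
have := @le_sum_measure _ _ _ P4 As Bs mAs mBs le_indic.
rewrite /As /Bs !big_cat !big_map !big_cons !big_nil /=.
rewrite P2 P3 probability_setT.
have PF' : (mu \x mu \x mu \x mu)%E F = (fine (P4 F))%:E := PF.
rewrite PF {}PF'.
rewrite !cube_sum//; do ?by move=> k; rewrite ?muA ?probability_setT ?mule1 ?mul1e -!EFinM; congr EFin; ring.
rewrite !square_sum; do ?by move=> k; ring.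
have regroup (p s3 s2 : R) :
    ((p + (p + (p + 0)) + (s3 + (s3 + (s3 + s3))))%:E <= (1 + 0 + (s2 + (s2 + s2)))%:E)%E ->
    3 * p + 4 * s3 <= 1 + 3 * s2 by rewrite lee_fin; lra.
exact: (regroup (fine (P4 F)) (\sum_k q k ^+ 3) ((\sum_k q k ^+ 2) ^+ 2)).
Qed.
End PairingBound.


(** * Measurability of the event *)

Section MeasurableCrossing.
Context {R : realType} {d : measure_display} {T : measurableType d}.
Implicit Types (u v : T -> R) (p q : T -> R * R).

Lemma measurable_set_lt u v : measurable_fun setT u -> measurable_fun setT v ->
  measurable [set z | u z < v z].
Proof.
move=> mu mv; have := measurable_fun_ltr mu mv measurableT (Y := [set true]).
by rewrite setTI; exact.
Qed.

Lemma measurable_set_eq u v : measurable_fun setT u -> measurable_fun setT v ->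
  measurable [set z | u z = v z].
Proof.
move=> mu mv; have := measurable_fun_eqr mu mv measurableT (Y := [set true]).
rewrite setTI => h; rewrite (_ : [set _ | _] = (fun z => u z == v z) @^-1` [set true]).
  exact: h.
by apply/seteqP; split => z /=; [move=> ->; rewrite eqxx|move/eqP].
Qed.

Lemma measurable_add u v : measurable_fun setT u -> measurable_fun setT v ->
  measurable_fun setT (fun z => u z + v z).
Proof. exact: measurable_funD. Qed.

Lemma measurable_sub u v : measurable_fun setT u -> measurable_fun setT v ->
  measurable_fun setT (fun z => u z - v z).
Proof. exact: measurable_funB. Qed.

Lemma measurable_mul u v : measurable_fun setT u -> measurable_fun setT v ->
  measurable_fun setT (fun z => u z * v z).
Proof. exact: measurable_funM. Qed.

Lemma measurable_sqr u : measurable_fun setT u ->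
  measurable_fun setT (fun z => u z ^+ 2).
Proof. exact: measurable_funX. Qed.

Lemma measurable_coord1 p : measurable_fun setT p -> measurable_fun setT (fun z => (p z).1).
Proof. by move=> mp; exact: measurableT_comp. Qed.

Lemma measurable_coord2 p : measurable_fun setT p -> measurable_fun setT (fun z => (p z).2).
Proof. by move=> mp; exact: measurableT_comp. Qed.

Lemma measurable_sqdist p q : measurable_fun setT p -> measurable_fun setT q ->
  measurable_fun setT (fun z => sqdist (p z) (q z)).
Proof.
move=> mp mq; rewrite /sqdist.
by apply: measurable_add; apply: measurable_sqr; apply: measurable_sub;
  by [exact: measurable_coord1|exact: measurable_coord2].
Qed.

Lemma measurable_set_eq2 p q : measurable_fun setT p -> measurable_fun setT q ->
  measurable [set z | p z = q z].
Proof.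
move=> mp mq; rewrite (_ : [set _ | _] = [set z | sqdist (p z) (q z) = 0]).
  by apply: measurable_set_eq => //; exact: measurable_sqdist.
apply/seteqP; split => z /=; first by move=> ->; apply/eqP; rewrite sqdist_eq0.
by move=> /eqP; rewrite sqdist_eq0 => /eqP.
Qed.

Lemma measurable_crosses_within (p1 p2 p3 p4 : T -> R * R) (r : R) :
  measurable_fun setT p1 -> measurable_fun setT p2 ->
  measurable_fun setT p3 -> measurable_fun setT p4 ->
  measurable [set z | crosses_within r (p1 z) (p2 z) (p3 z) (p4 z)].
Proof.
move=> mp1 mp2 mp3 mp4.
have [m11 m12] := (measurable_coord1 mp1, measurable_coord2 mp1).
have [m21 m22] := (measurable_coord1 mp2, measurable_coord2 mp2).
have [m31 m32] := (measurable_coord1 mp3, measurable_coord2 mp3).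
have [m41 m42] := (measurable_coord1 mp4, measurable_coord2 mp4).
pose D z := cross_den (p1 z) (p2 z) (p3 z) (p4 z).
pose J z := cross_par (p1 z) (p3 z) (p4 z).
have mD : measurable_fun setT D.
  by rewrite /D /cross_den; do ![apply: measurable_sub | apply: measurable_mul].
have mJ : measurable_fun setT J.
  by rewrite /J /cross_par; do ![apply: measurable_sub | apply: measurable_mul].
rewrite (_ : [set _ | _] =
    (~` [set z | D z = 0] `&`
      [set z | (D z * (p1 z).1 + J z * ((p2 z).1 - (p1 z).1)) ^+ 2 +
               (D z * (p1 z).2 + J z * ((p2 z).2 - (p1 z).2)) ^+ 2 < r ^+ 2 * D z ^+ 2]) `|`
    (([set z | p1 z = p3 z] `&` [set z | p2 z = p4 z] `|`
      [set z | p1 z = p4 z] `&` [set z | p2 z = p3 z]) `&`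
      [set z | 4 * (1 - r ^+ 2) < sqdist (p1 z) (p2 z)])).
  apply: measurableU; apply: measurableI.
  - by apply: measurableC; apply: measurable_set_eq.
  - apply: measurable_set_lt; last by apply: measurable_mul => //; exact: measurable_sqr.
    by apply: measurable_add; apply: measurable_sqr; apply: measurable_add;
      apply: measurable_mul => //; apply: measurable_sub.
  - by apply: measurableU; apply: measurableI; apply: measurable_set_eq2.
  - by apply: measurable_set_lt => //; apply: measurable_sqdist.
apply/seteqP; split => z /=; rewrite /crosses_within.
  by case=> [[/eqP]|]; [left|right].
by case=> [[/eqP]|]; [left|right].
Qed.

End MeasurableCrossing.

Section CircleMeasurability.
Context {R : realType}.
Local Notation S1 := (borel_circle R).

(** Open rays generate the Borel sets of the line, and their preimages are open, hence among the
    generators on the circle. *)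
Lemma continuous_measurable_circle (g : circle R -> R) :
  continuous g -> measurable_fun [set: S1] (g : S1 -> R).
Proof.
move=> /continuousP cg; apply: (measurability _ (RGenOInfty.measurableE R)).
move=> _ [_ [a ->] <-]; rewrite setTI; apply: sub_sigma_algebra.
apply: cg; exact: rray_open.
Qed.

Lemma measurable_abscissa : measurable_fun [set: S1] (fun x : S1 => (val x).1).
Proof.
apply: continuous_measurable_circle => x.
apply: (@continuous_comp _ _ _ (@set_val _ (@unit_circle R)) fst).
  exact: initial_continuous.
exact: cvg_fst.
Qed.

Lemma measurable_ordinate : measurable_fun [set: S1] (fun x : S1 => (val x).2).
Proof.
apply: continuous_measurable_circle => x.
apply: (@continuous_comp _ _ _ (@set_val _ (@unit_circle R)) snd).
  exact: initial_continuous.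
exact: cvg_snd.
Qed.

Lemma measurable_val_circle :
  measurable_fun [set: S1] (fun x : S1 => (val x : R * R)).
Proof.
rewrite (_ : (fun _ => _) = (fun x : S1 => ((val x).1, (val x).2))).
  exact: measurable_fun_pair measurable_abscissa measurable_ordinate.
by apply/funext => x; rewrite -surjective_pairing.
Qed.

Lemma measurable_f_lt (r : R) : 0 < r <= 1 ->
  measurable [set x : S1 * S1 * S1 * S1 | (f x.1.1.1 x.1.1.2 x.1.2 x.2 < r%:E)%E].
Proof.
move=> r01; rewrite (_ : [set _ | _] = [set x : S1 * S1 * S1 * S1 |
    crosses_within r (val x.1.1.1) (val x.1.1.2) (val x.1.2) (val x.2)]).
  apply: measurable_crosses_within; apply: (measurableT_comp measurable_val_circle).
  - by do 2 apply: measurableT_comp => //.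
  - by do 2 apply: measurableT_comp => //.
  - exact: measurableT_comp.
  - by [].
by apply/seteqP; split => x /=; rewrite f_ltE.
Qed.

End CircleMeasurability.

(** * Cutting the circle by a square grid of mesh [1 / m] *)

Section GridCells.
Context {R : realType}.
Variable m : nat.

(* Coordinates on the circle lie in [-1, 1], so [inord] never meets an index out
   of range there. *)
Definition grid_index (t : R) : 'I_(m.*2.+1) := inord (Num.truncn (m%:R * (1 + t))).

Definition grid_cell (p : R * R) : 'I_(#|{: 'I_(m.*2.+1) * 'I_(m.*2.+1)}|) :=
  enum_rank (grid_index p.1, grid_index p.2).

Lemma grid_indexP t (i : 'I_(m.*2.+1)) : -1 <= t <= 1 ->
  grid_index t = i <-> i%:R <= m%:R * (1 + t) < i.+1%:R.
Proof.
move=> /andP[t1 t2].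
have mt0 : 0 <= m%:R * (1 + t) by rewrite mulr_ge0//; lra.
have tr := truncn_itv mt0.
(* The endpoint [t = 1] has index exactly [2 m], hence [m.*2.+1] indices rather than [2 m]. *)
have ub : (Num.truncn (m%:R * (1 + t)) < m.*2.+1)%N.
  rewrite ltnS -(ler_nat R); apply: le_trans (andP tr).1 _.
  by rewrite -muln2 natrM ler_wpM2l//; lra.
split=> [<-|h]; first by rewrite inordK.
apply/val_inj; rewrite /= inordK//; apply/eqP.
by rewrite truncn_eq.
Qed.

End GridCells.


Section CircleGrid.
Context {R : realType}.
Variable m : nat.
Local Notation S1 := (borel_circle R).

Lemma circle_coord1 (x : circle R) : -1 <= (val x).1 <= 1.
Proof. by have := sqnorm_circle x; rewrite /sqnorm !expr2; nra. Qed.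

Lemma circle_coord2 (x : circle R) : -1 <= (val x).2 <= 1.
Proof. by have := sqnorm_circle x; rewrite /sqnorm !expr2; nra. Qed.

Lemma grid_index_close (s t : R) : (0 < m)%N -> -1 <= s <= 1 -> -1 <= t <= 1 ->
  grid_index m s = grid_index m t -> (s - t) ^+ 2 < (m%:R ^+ 2)^-1.
Proof.
move=> m0 s1 t1 e.
have mR : 0 < m%:R :> R by rewrite ltr0n.
have [/(_ e) /andP[a1 a2] _] := grid_indexP (grid_index m t) s1.
have [/(_ erefl) /andP[b1 b2] _] := grid_indexP (grid_index m t) t1.
rewrite -natr1 in a2 b2.
have h1 : m%:R * (s - t) < 1 by lra.
have h2 : -1 < m%:R * (s - t) by lra.
have h3 : (m%:R * (s - t)) ^+ 2 < 1 by rewrite expr2; nra.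
rewrite -[ltRHS]mul1r ltr_pdivlMr ?exprn_gt0//.
by move: h3; rewrite exprMn mulrC.
Qed.

Lemma grid_cell_close (x y : circle R) : (0 < m)%N ->
  grid_cell m (val x) = grid_cell m (val y) ->
  sqdist (val x) (val y) < 2 / m%:R ^+ 2.
Proof.
move=> m0 /enum_rank_inj[/grid_index_close h1 /grid_index_close h2].
have := h1 m0 (circle_coord1 x) (circle_coord1 y).
have := h2 m0 (circle_coord2 x) (circle_coord2 y).
by rewrite /sqdist; lra.
Qed.

Lemma measurable_grid_cell k : (0 < m)%N ->
  measurable ((fun x : S1 => grid_cell m (val x)) @^-1` [set k]).
Proof.
move=> m0.
have mslab (u : S1 -> R) (i : 'I_(m.*2.+1)) : measurable_fun setT u ->
    measurable [set x | i%:R <= m%:R * (1 + u x) < i.+1%:R].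
  move=> mu; rewrite (_ : [set _ | _] =
    ~` [set x | m%:R * (1 + u x) < i%:R] `&` [set x | m%:R * (1 + u x) < i.+1%:R]).
    have mg : measurable_fun setT (fun x => m%:R * (1 + u x)).
      by apply: measurable_mul => //; apply: measurable_add.
    by apply: measurableI; [apply: measurableC|]; apply: measurable_set_lt.
  apply/seteqP; split => x /=; first by move=> /andP[]; rewrite leNgt => /negP.
  by move=> [/negP]; rewrite -leNgt => -> ->.
pose ij := enum_val k.
(* A cell is the intersection of a vertical and a horizontal slab, given by the two indices encoded
   in [k]. *)
rewrite (_ : _ @^-1` _ =
    [set x : S1 | ij.1%:R <= m%:R * (1 + (val x).1) < ij.1.+1%:R] `&`
    [set x : S1 | ij.2%:R <= m%:R * (1 + (val x).2) < ij.2.+1%:R]).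
  apply: measurableI; apply: mslab; [exact: measurable_abscissa|exact: measurable_ordinate].
apply/seteqP; split => x /=.
  move=> e; have -> : ij = (grid_index m (val x).1, grid_index m (val x).2).
    by rewrite /ij -e /grid_cell enum_rankK.
  split; first by apply/grid_indexP => //; exact: circle_coord1.
  by apply/grid_indexP => //; exact: circle_coord2.
move=> [/(grid_indexP _ (circle_coord1 x)) e1 /(grid_indexP _ (circle_coord2 x)) e2].
by rewrite /grid_cell e1 e2 -surjective_pairing enum_valK.
Qed.

End CircleGrid.

(** * Choice of the mesh and the final estimate *)

(** Chords meeting the disk of radius [1 - theta] have squared length at least of order [theta], so
    a mesh of order [sqrt theta] separates their ends. The grid then has
    [N = (2 m + 1)^2 = O(1 / theta)] cells, and [1 / N^2] is of order at least [theta^2]. *)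
Lemma fine_grid (R : realType) (theta : R) : 0 < theta < 1 / 2 ->
  exists m : nat, [/\ (0 < m)%N, 2 / m%:R ^+ 2 <= 4 * (1 - (1 - theta) ^+ 2)
    & 1 / 1875 * theta ^+ 2 <= 1 / (3 * (#|{: 'I_(m.*2.+1) * 'I_(m.*2.+1)}|)%:R ^+ 2)].
Proof.
move=> /andP[t0 t1].
pose s := Num.sqrt theta.
have s0 : 0 < s by rewrite sqrtr_gt0.
have ss : s * s = theta by rewrite -expr2 sqr_sqrtr// ltW.
have s1 : s < 1 by nra.
(* This choice gives [1 < m s <= 1 + s]: the lower bound makes cells small enough, the upper one
   limits their number. *)
pose m := (Num.truncn (s^-1)).+1.
have i0 : 0 <= s^-1 by rewrite invr_ge0 ltW.
have /andP[lo hi] := truncn_itv i0.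
have lo' : (Num.truncn s^-1)%:R * s <= 1 by rewrite -ler_pdivlMr// div1r.
have hi' : 1 < m%:R * s by rewrite -ltr_pdivrMr// div1r.
have mn : m%:R = (Num.truncn s^-1)%:R + 1 :> R by rewrite natr1.
have mm : 1 <= m%:R ^+ 2 * theta.
  by rewrite -ss; have := ltW hi'; rewrite expr2; nra.
have mp : 0 < m%:R ^+ 2 :> R by rewrite exprn_gt0// ltr0n.
exists m; split => //.
  rewrite ler_pdivrMr//.
  have -> : 4 * (1 - (1 - theta) ^+ 2) * m%:R ^+ 2 = 4 * (m%:R ^+ 2 * theta) * (2 - theta).
    by ring.
  nra.
rewrite card_prod card_ord natrM.
(* [a <= 2 (1 + s) + s <= 5], and [3 N^2 theta^2 = 3 a^4 <= 3 * 5^4 = 1875]. *)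
set a : R := m.*2.+1%:R * s.
have a5 : a <= 5.
  by rewrite /a -natr1 -muln2 natrM; nra.
have a0 : 0 <= a by rewrite /a mulr_ge0// ltW.
have a4 : a ^+ 4 <= 5 ^+ 4 by apply: lerXn2r; rewrite ?nnegrE.
have K0 : 0 < m.*2.+1%:R :> R by rewrite ltr0n.
rewrite ler_pdivlMr; last by rewrite mulr_gt0// exprn_gt0// mulr_gt0.
have -> : 1 / 1875 * theta ^+ 2 * (3 * (m.*2.+1%:R * m.*2.+1%:R) ^+ 2) = a ^+ 4 / 625.
  by rewrite /a -ss; field.
lra.
Qed.

Theorem theorem1p3 (R : realType) :
  exists C theta0 : R, 0 < C /\ 0 < theta0 < 1 /\
    forall (mu : probability (borel_circle R) R) (theta : R),
      0 < theta < theta0 ->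
      (prob_ell_lt mu (1 - theta) <= (1 / 3 - C * theta ^+ 2)%:E)%E.
Proof.
exists (1 / 1875), (1 / 2); split; first lra; split; first lra.
move=> mu theta t01; have [m [m0 short small]] := fine_grid t01.
have r0 : 0 < 1 - theta by lra.
have r1 : 1 - theta <= 1 by lra.
have r01 : 0 < 1 - theta <= 1 by rewrite r0.
pose c (x : borel_circle R) := grid_cell m (val x).
(* Two points in one cell have squared distance below [2 / m^2], which [short] bounds by the minimal
   squared length of a contributing chord. *)
have long (x y : circle R) : 4 * (1 - (1 - theta) ^+ 2) < sqdist (val x) (val y) ->
    c x != c y.
  move=> h; apply/eqP => /(grid_cell_close m0) h'.
  by have := lt_trans (lt_le_trans h' short) h; rewrite ltxx.
apply: (@le_trans _ _ (1 / 3 - 1 / (3 * (#|{: 'I_(m.*2.+1) * 'I_(m.*2.+1)}|)%:R ^+ 2))%:E).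
  apply: (pairing_bound mu (c := c)).
  - by move=> k; exact: measurable_grid_cell.
  - exact: measurable_f_lt.
  - by move=> x1 x2 x3 x4 /=; rewrite /f (affC x4).
  - move=> x1 x2 x3 x4 /= /(f_lt_chord_long r0 r1)[h12 h34].
    by split; apply: long.
  - by move=> x1 x2 x3 x4 /= h /(f_lt_two_pairings r0 r1 h)[-> ->].
by rewrite lee_fin; lra.
Qed.
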